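(* Let $N\ge2$, $d=\pi(N)$, $p_1<\dots<p_d$ the primes up to $N$, and for $n=\prod_jp_j^{\kappa_j}\le N$ let $z(n)=\prod_jz_j^{\kappa_j}$ for $z\in\mathbb{T}^d$. Set $F_N(z)=\sum_{n=1}^Nz(n)/\sqrt n$. Fix $\varepsilon>0$. If $q\ge N^\varepsilon$, then \[\|F_N\|_{L^q(\mathbb{T}^{\pi(N)})}\gg_\varepsilon\sqrt N\] as $N\to\infty$, where $\|F\|_{L^q(\mathbb{T}^d)}=\big(\int_{\mathbb{T}^d}|F(z)|^q\,d\mu_d(z)\big)^{1/q}$.
   Context: $\mathbb{T}^d$ is the polytorus $\{(z_1,\dots,z_d):|z_j|=1\}$ with normalized product Lebesgue (Haar) measure $\mu_d$; $\pi(N)$ is the number of primes $\le N$. The implied constant depends only on $\varepsilon$. *)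

(* Defs.v *)
From HB Require Import structures.
From mathcomp Require Import all_boot all_order all_algebra.
From mathcomp Require Import all_classical all_reals all_analysis.
Set Implicit Arguments. Unset Strict Implicit. Unset Printing Implicit Defensive.
Import Order.TTheory GRing.Theory Num.Theory.
Local Open Scope ring_scope.

Definition primes_upto (N : nat) : seq nat := [seq p <- iota 0 N.+1 | prime p].

Section Torus.
Variable R : realType.

(* A point of T^{pi(N)} is z_p = exp(2 pi i t p) for p prime <= N,
   encoded by angles t : nat -> R (only coordinates p in primes_upto N matter). *)
(* argument of z(n)/(2 pi):  sum_p kappa_p(n) t_p, kappa_p(n) = logn p n *)
Definition phase (N n : nat) (t : nat -> R) : R :=
  \sum_(p <- primes_upto N) (logn p n)%:R * t p.

Definition ReF (N : nat) (t : nat -> R) : R :=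
  \sum_(1 <= n < N.+1) cos (2 * pi * phase N n t) / Num.sqrt n%:R.
Definition ImF (N : nat) (t : nat -> R) : R :=
  \sum_(1 <= n < N.+1) sin (2 * pi * phase N n t) / Num.sqrt n%:R.

Definition absF (N : nat) (t : nat -> R) : R :=
  Num.sqrt (ReF N t ^+ 2 + ImF N t ^+ 2).

(* Integral against normalized Haar measure on the torus with coordinates
   indexed by s, as an iterated integral of angles over [0,1). *)
Fixpoint torus_int (s : seq nat) (f : (nat -> R) -> \bar R) (t : nat -> R)
  : \bar R :=
  match s with
  | [::] => f t
  | p :: s' => (\int[@lebesgue_measure R]_(x in `[0%R, 1%R[%classic)
                 torus_int s' f (fun k => if k == p then x else t k))%E
  end.

Definition LqF (N : nat) (q : R) : R :=
  (fine (torus_int (primes_upto N) (fun t => ((absF N t) `^ q)%:E) (fun _ => 0)))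
    `^ q^-1.

End Torus.

(* Main.v *)
Require Import Defs.
From HB Require Import structures.
From mathcomp Require Import all_boot all_order all_algebra.
From mathcomp Require Import all_classical all_reals all_analysis.
From mathcomp Require Import measurable_realfun ring lra.
Import Order.TTheory GRing.Theory Num.Theory.
Import numFieldNormedType.Exports.
Local Open Scope ring_scope.

(** Put w = floor(N^(eps/12)) and y = w^6 <= N^(eps/2).  Integrating F_N over
    the coordinates z_p with p > y keeps exactly the terms with n y-smooth.  When
    the remaining at most y angles all lie in [0, N^-7], every smooth term has
    argument at most pi/4, so this mean has real part at least
    cos(pi/4) Psi(N, y) / sqrt N, where Psi(N, y) counts the y-smooth n <= N.
    The tangent line of u |-> u^q turns this into a bound for the inner integral
    of |F_N|^q, and the small box has measure at least N^(-7(y+1)), whose q-th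
    root stays away from 0 because y ln N << N^eps <= q.

    It remains to see that Psi(N, w^6) >= c_k N for N <= w^k.  An integer up to
    w^k has at most k prime factors p > w, so
    k Psi(x, w^6) >= sum_(w < p <= w^6) Psi(x/p, w^6), and induction on k reduces
    the claim to sum_(w < p <= w^6) 1/p >= 1/12, which follows from the
    factorization of (w^6)! into primes. *)

(** * Reciprocals of primes *)

(** By Legendre's formula the exponent is a sum of floors of n / p^i, dominated by the geometric
    series with sum n / (p-1). *)
Lemma logn_fact_ub p n : prime p -> (p.-1 * logn p n`! <= n)%N.
Proof.
move=> pp; rewrite logn_fact//.
(* The extra term makes the induction close: p times the floor of n / p^(k+1) is at most the floor
   of n / p^k. *)
suff H k : (p.-1 * (\sum_(1 <= i < k.+1) n %/ p ^ i) + n %/ p ^ k <= n)%N.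
  exact: leq_trans (leq_addr _ _) (H n).
elim: k => [|k IH]; first by rewrite big_geq// muln0 add0n expn0 divn1.
apply: leq_trans IH; rewrite big_nat_recr//= mulnDr -addnA leq_add2l.
rewrite -mulSnr prednK ?prime_gt0// expnSr divnMA mulnC.
exact: leq_divM.
Qed.

Lemma logn_fact_lb p n : prime p -> (n %/ p <= logn p n`!)%N.
Proof.
move=> pp; rewrite logn_fact//.
case: n => [|n]; first by rewrite div0n.
by rewrite big_nat_recl//= expn1 leq_addr.
Qed.

Section Mertens.
Variable R : realType.
Implicit Types (n p w : nat).

(** The remainder of n modulo p is below p, hence at most the multiple of p that precedes it,
    because the quotient is positive. *)
Lemma natr_div_lb p n : (0 < p <= n)%N ->
  n%:R / (2 * p%:R) <= (n %/ p)%:R :> R.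
Proof.
move=> /andP[p0 pn]; rewrite ler_pdivrMr ?mulr_gt0 ?ltr0n//.
rewrite -!natrM ler_nat mulnCA mul2n -addnn {1}(divn_eq n p).
rewrite leq_add2l; apply: (@leq_trans p); first by rewrite ltnW ?ltn_mod.
by rewrite leq_pmull// divn_gt0.
Qed.

Lemma ln_ge1_nat_gt1 n : 1 <= ln (n%:R : R) -> (2 <= n)%N.
Proof.
(* [ln] takes the value 0 at 0, so n = 0 is excluded just as n = 1 is. *)
case: n => [|[|n]]//; first by rewrite ln0// ler10.
by rewrite ln1 ler10.
Qed.

(** The range extends to a common bound M so that the identities for the factors of a factorial can
    be added prime by prime. *)
Lemma ln_nat_logn n M : (0 < n <= M)%N ->
  ln n%:R = \sum_(0 <= p < M.+1 | prime p) (logn p n)%:R * ln p%:R :> R.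
Proof.
move=> /andP[n0 nM].
have {1}-> : n = (\prod_(0 <= p < M.+1 | prime p) p ^ logn p n)%N.
  rewrite -[LHS](@part_pnat_id predT); last by apply/pnatP.
  rewrite (widen_partn _ nM) [RHS]big_mkcond /=; apply: eq_bigr => p _.
  by case: ifP => // np; rewrite lognE np.
(* Positivity of the partial products is carried along because [lnM] asks for it. *)
suff [] : (0 < \prod_(0 <= p < M.+1 | prime p) p ^ logn p n)%N /\
   ln (\prod_(0 <= p < M.+1 | prime p) p ^ logn p n)%:R =
   \sum_(0 <= p < M.+1 | prime p) (logn p n)%:R * ln p%:R :> R by [].
elim/big_rec2: _ => [|p a b pp [b0 <-]]; first by rewrite ln1.
have p0 := prime_gt0 pp.
split; first by rewrite muln_gt0 expn_gt0 p0.
by rewrite natrM lnM ?posrE ?ltr0n ?expn_gt0 ?p0// natrX lnXn ?ltr0n// mulr_natl.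
Qed.

Lemma ln_fact_logn n M : (n <= M)%N ->
  ln n`!%:R = \sum_(0 <= p < M.+1 | prime p) (logn p n`!)%:R * ln p%:R :> R.
Proof.
elim: n => [_|n IH nM].
  by rewrite fact0 ln1 big1// => p _; rewrite logn1 mul0r.
rewrite factS natrM lnM ?posrE ?ltr0n ?fact_gt0// IH ?(ltnW nM)//.
rewrite (@ln_nat_logn n.+1 M)// -big_split/=; apply: eq_bigr => p pp.
by rewrite lognM ?fact_gt0// natrD mulrDl.
Qed.

Lemma ln_fact_ub n : ln n`!%:R <= n%:R * ln n%:R :> R.
Proof.
case: n => [|n]; first by rewrite fact0 ln1 mul0r.
have : (n.+1`! <= n.+1 ^ n.+1)%N.
  suff H m : (m <= n.+1)%N -> (m`! <= n.+1 ^ m)%N by exact: H.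
  elim: m => // m IH mn; rewrite factS expnS leq_mul// IH// ltnW//.
rewrite -(ler_nat R) => h.
rewrite mulr_natl -lnXn ?ltr0n// -natrX ler_ln ?posrE ?ltr0n ?fact_gt0//.
by rewrite expn_gt0.
Qed.

(** Passing from m to m+1 costs m (ln(m+1) - ln m), which is at most 1 by ln(1 + 1/m) <= 1/m. *)
Lemma ln_fact_lb n : n%:R * ln n%:R - n%:R <= ln n`!%:R :> R.
Proof.
elim: n => [|n IH]; first by rewrite fact0 ln1 mul0r subr0.
rewrite factS natrM lnM ?posrE ?ltr0n ?fact_gt0//.
case: n IH => [|n] IH; first by rewrite fact0 ln1 mulr0; lra.
set m := n.+1 in IH *.
have m0 : 0 < m%:R :> R by rewrite ltr0n.
have h : m%:R * (ln m.+1%:R - ln m%:R) <= 1 :> R.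
  rewrite -ln_div ?posrE ?ltr0n//.
  have -> : m.+1%:R / m%:R = 1 + m%:R^-1 :> R.
    by rewrite -addn1 natrD mulrDl divff ?gt_eqF// mul1r.
  have mV : 0 < m%:R^-1 :> R by rewrite invr_gt0.
  have /(ler_wpM2l (ltW m0)) := @le_ln1Dx R m%:R^-1 (lt_trans (ltrN10 _) mV).
  by rewrite divff ?gt_eqF.
have -> : m.+1%:R = m%:R + 1 :> R by rewrite -addn1 natrD.
move: h IH; have -> : m.+1%:R = m%:R + 1 :> R by rewrite -addn1 natrD.
lra.
Qed.

(** A prime p <= w has exponent at least w / (2p) in w!, while ln w! <= w ln w. *)
Lemma mertens_ub w : (0 < w)%N ->
  \sum_(0 <= p < w.+1 | prime p) ln p%:R / p%:R <= 2 * ln w%:R :> R.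
Proof.
move=> w0.
have w0' : 0 < w%:R :> R by rewrite ltr0n.
have w2 : 0 < w%:R / 2 :> R by rewrite divr_gt0.
rewrite -(ler_pM2l w2) mulrA divfK//.
apply: le_trans (ln_fact_ub w); rewrite (@ln_fact_logn w w)//.
rewrite mulr_sumr big_nat_cond [leRHS]big_nat_cond.
apply: ler_sum => p /andP[/andP[_ pw] pp].
have -> : w%:R / 2 * (ln p%:R / p%:R) = w%:R / (2 * p%:R) * ln p%:R :> R.
  by rewrite invfM; ring.
rewrite ler_wpM2r ?ln_ge0 ?ler1n ?prime_gt0//.
apply: le_trans (_ : (w %/ p)%:R <= _); last by rewrite ler_nat logn_fact_lb.
by apply: natr_div_lb; rewrite prime_gt0.
Qed.

(* With n = w^6, the primes up to w contribute at most 4 n ln w to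
   ln n! >= n (6 ln w - 1). *)
Lemma prime_recip_window w : 1 <= ln (w%:R : R) ->
  12^-1 <= \sum_(w.+1 <= p < (w ^ 6).+1 | prime p) (p%:R)^-1 :> R.
Proof.
move=> L1; have w2 := ln_ge1_nat_gt1 _ L1.
have w0 : (0 < w)%N by apply: ltnW.
set n := (w ^ 6)%N; set L := ln _ in L1; set T := \sum_(_ <= p < _ | _) _.
have n0 : 0 < n%:R :> R by rewrite ltr0n expn_gt0 w0.
have wn : (w <= n)%N by rewrite -{1}(expn1 w) leq_exp2l.
have lnn : ln n%:R = 6 * L by rewrite natrX lnXn ?ltr0n// mulr_natl.
have := ln_fact_lb n; rewrite (@ln_fact_logn n n)// lnn.
rewrite (big_cat_nat (n := w.+1))//=.
(* The exponent is at most n / (p-1), and p <= 2 (p-1). *)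
have v p : prime p -> (logn p n`!)%:R <= 2 * n%:R / p%:R :> R.
  move=> pp; rewrite ler_pdivlMr ?ltr0n ?prime_gt0// -!natrM ler_nat.
  apply: leq_trans (_ : 2 * (p.-1 * logn p n`!) <= _)%N; last first.
    by rewrite leq_mul2l logn_fact_ub.
  rewrite mulnA mulnC leq_mul2r; case: p pp => [|[|p]]//= _.
  by rewrite mulSn addnC mul1n addSn ltnS leq_addl orbT.
have lnp p : prime p -> 0 <= ln (p%:R : R).
  by move=> pp; rewrite ln_ge0// ler1n prime_gt0.
have h1 : \sum_(0 <= p < w.+1 | prime p) (logn p n`!)%:R * ln p%:R
    <= 2 * n%:R * (2 * L).
  apply: le_trans (ler_wpM2l _ (mertens_ub _ w0)); last by rewrite mulr_ge0 ?ltW.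
  rewrite mulr_sumr; apply: ler_sum => p pp.
  have -> : 2 * n%:R * (ln p%:R / p%:R) = 2 * n%:R / p%:R * ln p%:R :> R by ring.
  by rewrite ler_wpM2r ?lnp// v.
have h2 : \sum_(w.+1 <= p < n.+1 | prime p) (logn p n`!)%:R * ln p%:R
    <= 2 * n%:R * (6 * L) * T.
  rewrite /T mulr_sumr big_nat_cond [leRHS]big_nat_cond.
  apply: ler_sum => p /andP[/andP[_ pn] pp].
  have -> : 2 * n%:R * (6 * L) / p%:R = (2 * n%:R / p%:R) * (6 * L) by ring.
  apply: ler_pM; rewrite ?lnp ?v//.
  rewrite -lnn ler_ln ?posrE ?ler_nat// ltr0n ?prime_gt0//.
move: h1 h2; set a := \sum_(0 <= p < _ | _) _; set b := \sum_(_ <= p < _ | _) _.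
move=> h1 h2 h3.
have nL : 0 < n%:R * L by rewrite mulr_gt0// (lt_le_trans ltr01).
(* As n <= n L, the total is at least 5 n L; the primes up to w take at most 4 n L, which leaves n L
   <= 12 n L T for the window. *)
have h4 : n%:R <= n%:R * L by rewrite ler_peMr// ltW.
rewrite -(ler_pM2l nL).
have : 2 * n%:R * (6 * L) * T = 12 * (n%:R * L * T) by ring.
have : 2 * n%:R * (2 * L) = 4 * (n%:R * L) by ring.
have : n%:R * (6 * L) = 6 * (n%:R * L) by ring.
lra.
Qed.

End Mertens.

(** * Smooth numbers *)

Definition smooth (y n : nat) : bool := all (fun p => p <= y)%N (primes n).

Definition smooth_count (y x : nat) : nat := count (smooth y) (iota 1 x).

Lemma smooth_le y n : (n <= y)%N -> smooth y n.
Proof.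
move=> ny; apply/allP => p; rewrite mem_primes => /and3P[_ n0 pn].
exact: leq_trans (dvdn_leq n0 pn) ny.
Qed.

Lemma smoothM y m n : (0 < m)%N -> (0 < n)%N ->
  smooth y m -> smooth y n -> smooth y (m * n).
Proof.
move=> m0 n0 /allP sm /allP sn; apply/allP => p.
by rewrite primesM// => /orP[/sm|/sn].
Qed.

Lemma prod_primes_dvd (s : seq nat) n : uniq s -> all prime s ->
  all (fun p => p %| n)%N s -> (\prod_(p <- s) p %| n)%N.
Proof.
elim: s => [|p s IH]/=; first by rewrite big_nil dvd1n.
move=> /andP[ps us] /andP[pp sp] /andP[pn sn].
rewrite big_cons Gauss_dvd ?pn ?IH//.
rewrite prime_coprime// Euclid_dvd_prod// big_has; apply/negP => /hasP[q qs].
rewrite dvdn_prime2 ?pp ?(allP sp _ qs)// => /eqP pq.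
by rewrite pq qs in ps.
Qed.

(** The product of the distinct primes counted divides n <= w^k, and each of its factors exceeds
    w. *)
Lemma count_large_prime_divisors w k n (s : seq nat) : (1 < w)%N ->
  (0 < n <= w ^ k)%N -> uniq s ->
  all (fun p => prime p && (w < p))%N s -> (count (fun p => p %| n) s <= k)%N.
Proof.
move=> w1 /andP[n0 nk] us sp.
rewrite -(leq_exp2l _ _ w1) -size_filter.
set t := [seq p <- s | p %| n]%N.
have tP p : p \in t -> [/\ prime p, (w < p)%N & (p %| n)%N].
  by rewrite mem_filter => /andP[pn /(allP sp)/andP[]].
apply: leq_trans nk; apply: leq_trans (_ : \prod_(p <- t) p <= _)%N.
  have : all (fun p => w < p)%N t by apply/allP => p /tP[].
  elim: t {tP} => [|p t IH]/=; first by rewrite big_nil.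
  by move=> /andP[wp /IH h]; rewrite big_cons expnS leq_mul// ltnW.
apply: dvdn_leq => //; apply: prod_primes_dvd; first exact: filter_uniq.
- by apply/allP => p /tP[].
- by apply/allP => p /tP[].
Qed.

(** Multiplication by p maps the y-smooth integers up to x / p injectively to y-smooth multiples of
    p up to x. *)
Lemma smooth_count_div y x p : prime p -> (p <= y)%N ->
  (smooth_count y (x %/ p) <= count (fun n => smooth y n && (p %| n)%N) (iota 1 x))%N.
Proof.
move=> pp py; have p0 := prime_gt0 pp.
rewrite /smooth_count -!size_filter -(size_map (fun m => p * m)%N).
apply: uniq_leq_size.
  rewrite map_inj_uniq ?filter_uniq ?iota_uniq// => a b /eqP.
  by rewrite eqn_pmul2l// => /eqP.
move=> _ /mapP[m + ->]; rewrite !mem_filter !mem_iota add1n ltnS dvdn_mulr// andbT.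
move=> /andP[sm /andP[m0 mx]]; rewrite smoothM ?(smooth_le _ _ py)//=.
by rewrite muln_gt0 p0 m0/= add1n ltnS mulnC -leq_divRL.
Qed.

(** Double counting of the pairs (p, n) with p in the window, n smooth and p dividing n: each n
    occurs in at most k of them. *)
Lemma smooth_count_step w k x : (1 < w)%N -> (x <= w ^ k)%N ->
  (\sum_(w.+1 <= p < (w ^ 6).+1 | prime p) smooth_count (w ^ 6) (x %/ p)
    <= k * smooth_count (w ^ 6) x)%N.
Proof.
move=> w1 xw; set y := (w ^ 6)%N.
apply: (@leq_trans (\sum_(w.+1 <= p < y.+1 | prime p)
    \sum_(n <- iota 1 x | smooth y n) (p %| n))%N).
  rewrite big_nat_cond [leqRHS]big_nat_cond.
  apply: leq_sum => p /andP[/andP[_ py] pp].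
  apply: leq_trans (smooth_count_div _ _ _ pp py) _.
  by rewrite -sum1_count big_mkcondr.
rewrite exchange_big/= /smooth_count -sum1_count big_distrr/=.
rewrite big_seq_cond [leqRHS]big_seq_cond.
apply: leq_sum => n; rewrite mem_iota add1n ltnS => /andP[/andP[n0 nx] _].
rewrite muln1 -big_filter.
have -> : (\sum_(i <- [seq p <- index_iota w.+1 y.+1 | prime p]) (i %| n) =
   count (fun p => p %| n) ([seq p <- index_iota w.+1 y.+1 | prime p]))%N.
  by rewrite -sum1_count [RHS]big_mkcond.
apply: (count_large_prime_divisors w) => //.
- by rewrite n0 (leq_trans nx).
- by rewrite filter_uniq ?iota_uniq.
- by apply/allP => p; rewrite mem_filter mem_index_iota => /andP[-> /andP[->]].
Qed.

(** The bound is uniform in w and in all x <= w^k, so that the induction hypothesis applies to every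
    x / p with p > w. *)
Lemma smooth_count_lb (R : realType) (k : nat) :
  exists2 c : R, 0 < c <= 1 & forall w x : nat, 1 <= ln (w%:R : R) ->
    (x <= w ^ k)%N -> c * x%:R <= (smooth_count (w ^ 6) x)%:R.
Proof.
have triv (c : R) y x : c <= 1 -> (x <= y)%N -> c * x%:R <= (smooth_count y x)%:R.
  move=> c1 xy; have -> : smooth_count y x = x.
    rewrite -{2}(size_iota 1 x); apply/eqP; rewrite -all_count; apply/allP => n.
    by rewrite mem_iota add1n ltnS => /andP[_ nx]; apply: smooth_le (leq_trans nx xy).
  by rewrite ler_piMl.
elim: k => [|k [c /andP[c0 c1] IH]].
  exists 1 => [|w x L1]; first by rewrite ltr01 lexx.
  rewrite expn0 => x1; apply: triv => //; apply: leq_trans x1 _.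
  by rewrite expn_gt0 (ltnW (ln_ge1_nat_gt1 _ _ L1)).
have k0 : 0 < k.+1%:R :> R by rewrite ltr0n.
have k1 : 1 <= k.+1%:R :> R by rewrite ler1n.
(* A factor 2 is lost in the floor of x / p, a factor 12 in the sum of the reciprocals, and k+1 in
   the double counting. *)
exists (c / (24 * k.+1%:R)) => [|w x L1 xw].
  rewrite divr_gt0 ?mulr_gt0//= ler_pdivrMr ?mulr_gt0//; lra.
have w1 := ln_ge1_nat_gt1 _ _ L1; have w0 := ltnW w1.
(* For x <= w^6 every integer counted is smooth; beyond that, each p of the window is at most x, as
   [natr_div_lb] requires. *)
have [xy|yx] := leqP x (w ^ 6).
  by apply: triv => //; rewrite ler_pdivrMr ?mulr_gt0//; lra.
have := smooth_count_step _ _ _ w1 xw; rewrite -(ler_nat R) natr_sum natrM.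
rewrite mulrAC ler_pdivrMr ?mulr_gt0//.
set S := (smooth_count _ x)%:R; move=> h.
suff : c * x%:R * 24^-1 <= k.+1%:R * S by lra.
apply: le_trans h.
apply: le_trans (_ : \sum_(w.+1 <= p < (w ^ 6).+1 | prime p) c * x%:R / 2 * p%:R^-1 <= _).
  rewrite -mulr_sumr.
  have -> : c * x%:R * 24^-1 = c * x%:R / 2 * 12^-1 by field.
  rewrite ler_wpM2l ?prime_recip_window//.
  by rewrite divr_ge0// mulr_ge0// ltW.
rewrite [leLHS]big_nat_cond [leRHS]big_nat_cond.
apply: ler_sum => p /andP[/andP[wp py] pp]; have p0 := prime_gt0 pp.
apply: le_trans (IH _ _ L1 _); last first.
  apply: leq_trans (leq_div2l x w0 (ltnW wp)) _.
  apply: leq_trans (leq_div2r w xw) _.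
  by rewrite expnS mulKn.
apply: le_trans (ler_wpM2l (ltW c0) (natr_div_lb R p x _)); last first.
  by rewrite p0/= (leq_trans _ (ltnW yx)).
by rewrite invfM !mulrA.
Qed.

(** * Integration over the torus *)

Section TorusIntegral.
Variable R : realType.
Local Notation leb := (@lebesgue_measure R).
Implicit Types (s : seq nat) (t : nat -> R).

Local Open Scope ereal_scope.

(** Monotonicity is read off the suprema over simple functions below the positive and negative
    parts. It thus applies to iterated integrals, whose measurability is never established. *)
Lemma le_integral_pointwise d (T : measurableType d)
    (mu : {measure set T -> \bar R}) (D : set T) (f g : T -> \bar R) :
  (forall x, D x -> f x <= g x) ->
  \int[mu]_(x in D) f x <= \int[mu]_(x in D) g x.
Proof.
move=> fg; rewrite /integral.
have fg' x : (f \_ D)%classic x <= (g \_ D)%classic x.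
  by rewrite /patch; case: ifPn => // /set_mem; exact: fg.
apply: leeB; apply: le_ereal_sup => _ [h hf <-]; exists h => // x /=;
  apply: le_trans (hf x) _; rewrite ?funeposE ?funenegE ge_max !le_max ?leeN2 fg' lexx orbT//=.
Qed.

Lemma integral01_antiderivative (f F : R -> R) : continuous f ->
  (forall x : R, is_derive x (1:R)%R F (f x)) ->
  \int[leb]_(x in `[0%R, 1%R[%classic) (f x)%:E = (F 1 - F 0)%R%:E.
Proof.
move=> cf dF.
have mf : measurable_fun setT f by exact: continuous_measurable_fun.
rewrite integral_itv_bndo_bndc; last first.
  by apply/measurable_EFinP; exact: measurable_funTS.
rewrite (@continuous_FTC2 R f F)//.
- exact: continuous_subspaceT.
- have cF x : {for x, continuous F}.
    by apply: differentiable_continuous; apply/derivable1_diffP; case: (dF x).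
  split.
  + by move=> x _; case: (dF x).
  + exact/cvg_at_right_filter/cF.
  + exact/cvg_at_left_filter/cF.
- by move=> x _; rewrite derive1E; case: (dF x).
Qed.

Lemma integral01_cst (c : R) :
  \int[leb]_(x in `[0%R, 1%R[%classic) c%:E = c%:E.
Proof.
have dF (x : R) : is_derive x (1:R)%R (fun x => c * x)%R c.
  by apply: is_derive_eq; rewrite /GRing.scale/= mulr1 ?mulr0 ?addr0 ?add0r.
have := @integral01_antiderivative (cst c) _ (@cst_continuous _ _ c) dF.
by rewrite mulr1 mulr0 subr0.
Qed.

(** A term of nonzero frequency has a 1-periodic antiderivative and so integrates to 0.
    Antiderivatives are summed along the list and the fundamental theorem is applied once to the
    total. *)
Lemma integral01_trig (r : seq nat) (a theta : nat -> R) (k : nat -> nat) (b : R) :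
  \int[leb]_(x in `[0%R, 1%R[%classic)
    (b + \sum_(n <- r) a n * cos (theta n + 2 * pi * ((k n)%:R * x)))%R%:E
  = (b + \sum_(n <- r | k n == 0%N) a n * cos (theta n))%R%:E.
Proof.
suff [F [cf dF <-]] : exists F : R -> R, [/\
    continuous (fun x : R => b + \sum_(n <- r) a n * cos (theta n + 2 * pi * ((k n)%:R * x)))%R,
    (forall x : R, is_derive x (1:R)%R F
       (b + \sum_(n <- r) a n * cos (theta n + 2 * pi * ((k n)%:R * x)))%R) &
    (F 1 - F 0 = b + \sum_(n <- r | k n == 0%N) a n * cos (theta n))%R].
  exact: integral01_antiderivative.
elim: r => [|n r [F [cf dF FE]]].
  exists (fun x : R => b * x)%R; split.
  - rewrite (_ : (fun _ => _) = cst b); first exact: cst_continuous.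
    by apply/funext => x; rewrite big_nil addr0.
  - move=> x; rewrite big_nil addr0; apply: is_derive_eq.
    by rewrite /GRing.scale/= mulr1 ?mulr0 ?addr0 ?add0r.
  - by rewrite big_nil mulr1 mulr0 subr0 addr0.
pose g (x : R) := (a n * cos (theta n + 2 * pi * ((k n)%:R * x)))%R.
have fE : (fun x : R => b + \sum_(i <- n :: r) a i * cos (theta i + 2 * pi * ((k i)%:R * x)))%R
   = (fun x : R => g x + (b + \sum_(i <- r) a i * cos (theta i + 2 * pi * ((k i)%:R * x))))%R.
  by apply/funext => x; rewrite big_cons addrCA.
have cg : continuous g.
  move=> x; apply: cvgM; first exact: cvg_cst.
  apply: continuous_comp; last exact: continuous_cos.
  apply: cvgD; first exact: cvg_cst.
  apply: cvgM; first exact: cvg_cst.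
  by apply: cvgM; [exact: cvg_cst|exact: cvg_id].
have [G dG GE] : exists2 G : R -> R, (forall x : R, is_derive x (1:R)%R G (g x)) &
    (G 1 - G 0 = if k n == 0%N then a n * cos (theta n) else 0)%R.
  have [k0|k0] := eqVneq (k n) 0%N.
    exists (fun x : R => a n * cos (theta n) * x)%R; last by rewrite mulr1 mulr0 subr0.
    move=> x; rewrite /g k0 mul0r mulr0 addr0; apply: is_derive_eq.
    by rewrite /GRing.scale/= mulr1 ?mulr0 ?addr0 ?add0r.
  have kn0 : (2 * pi * (k n)%:R != 0 :> R)%R.
    by rewrite !mulf_neq0 ?pnatr_eq0// gt_eqF// pi_gt0.
  exists (fun x : R => a n / (2 * pi * (k n)%:R) * sin (theta n + 2 * pi * ((k n)%:R * x)))%R.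
    move=> x; apply: is_derive_eq.
    rewrite /GRing.scale/= /g ?mulr1 ?mulr0 ?addr0 ?add0r.
    move: kn0; set c := (2 * pi * _)%R => kn0.
    by rewrite mulrA -/c; field.
  rewrite -mulrBr mulr1 !mulr0 addr0.
  suff -> : (sin (theta n + 2 * pi * (k n)%:R) = sin (theta n))%R by rewrite subrr mulr0.
  elim: (k n) => [|m IH]; first by rewrite mulr0 addr0.
  rewrite -[RHS]IH -[RHS]sinD2pi.
  by congr (sin _); rewrite -natr1; ring.
exists (fun x : R => G x + F x)%R; split.
- rewrite fE => x; apply: cvgD; [exact: cg | exact: cf].
- move=> x; rewrite (congr1 (@^~ x) fE); exact: is_deriveD.
- rewrite big_cons; case: ifP GE => _ GE; rewrite opprD addrACA GE FE.
    by rewrite addrCA.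
  by rewrite add0r.
Qed.

Lemma le_torus_int s (f g : (nat -> R) -> \bar R) t :
  (forall t, f t <= g t) -> torus_int s f t <= torus_int s g t.
Proof.
by move=> fg; elim: s t => //= p s IH t; apply: le_integral_pointwise => x _.
Qed.

Lemma torus_int_cst s (c : R) t : torus_int s (fun=> c%:E) t = c%:E.
Proof.
elim: s t => //= p s IH t; rewrite -[RHS]integral01_cst.
by apply: eq_integral => x _.
Qed.

Lemma torus_int_cat s1 s2 (f : (nat -> R) -> \bar R) t :
  torus_int (s1 ++ s2) f t = torus_int s1 (torus_int s2 f) t.
Proof. by elim: s1 t => //= p s1 IH t; apply: eq_integral => x _. Qed.

Lemma torus_int_box s (G : (nat -> R) -> \bar R) (c delta : R) t :
  (0 <= c)%R -> (0 < delta <= 1)%R -> (forall t, 0 <= G t) ->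
  (forall t, (forall p, p \in s -> 0 <= t p <= delta)%R -> c%:E <= G t) ->
  (c * delta ^+ size s)%:E <= torus_int s G t.
Proof.
(* Peeling off the last coordinate turns the innermost integral into the new integrand, with c delta
   in place of c. *)
move=> c0 /andP[d0 d1]; elim/last_ind: s G c c0 => [|s p IH] G c c0 G0 Gc.
  by rewrite expr0 mulr1; exact: Gc.
rewrite -cats1 torus_int_cat size_cat/= addn1 exprS mulrA.
apply: IH => [|u|u us].
- by rewrite mulr_ge0// ltW.
- exact: integral_ge0.
- apply: (@le_trans _ _ (\int[leb]_(x in `[0%R, 1%R[%classic)
     ((fun=> c%:E) \_ `[0%R, delta[%classic) x)); last first.
    apply: le_integral_pointwise => x _; rewrite /patch; case: ifPn => // xd.
    apply: Gc => q; rewrite mem_rcons inE; case: eqVneq => [_ _|_ /= /us//].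
    by move: xd; rewrite inE/= in_itv/= => /andP[-> /ltW].
  rewrite -integral_mkcondr.
  have -> : (`[0%R, 1%R[ `&` `[0%R, delta[)%classic = `[0%R, delta[%classic :> set R.
    apply/seteqP; split => x /=; first by case.
    rewrite !in_itv/= => /andP[x0 xd]; rewrite x0 xd.
    by rewrite (lt_le_trans xd).
  rewrite integral_cst//= lebesgue_measure_itv/= lte_fin d0.
  by rewrite oppr0 adde0 -EFinM.
Qed.

End TorusIntegral.

(** * The lower bound *)

Section LowerBound.
Variable R : realType.
Implicit Types (s : seq nat) (t : nat -> R) (n p N : nat).

Lemma primes_upto_uniq N : uniq (primes_upto N).
Proof. by rewrite filter_uniq ?iota_uniq. Qed.

Lemma phase_update N n p (x : R) t : p \in primes_upto N ->
  phase N n (fun k => if k == p then x else t k) =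
  phase N n (fun k => if k == p then 0 else t k) + (logn p n)%:R * x.
Proof.
move=> pN; rewrite /phase !(bigD1_seq p) ?primes_upto_uniq//= !eqxx.
rewrite mulr0 add0r addrC; congr (_ + _).
by apply: eq_bigr => q /negbTE ->.
Qed.

Lemma phase_update0 N n p (x : R) t : logn p n = 0%N ->
  phase N n (fun k => if k == p then x else t k) = phase N n t.
Proof.
move=> np; apply: eq_bigr => q _; case: eqVneq => // ->.
by rewrite np !mul0r.
Qed.

(** Averaging over one z_p kills the terms in which p occurs. The constant b allows an affine
    minorant of |F_N|^q to be integrated in one piece. *)
Lemma torus_int_trig N s (r : seq nat) (a : nat -> R) (b : R) t :
  {subset s <= primes_upto N} ->
  torus_int s (fun t => (b + \sum_(n <- r) a n * cos (2 * pi * phase N n t))%:E) t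
  = (b + \sum_(n <- r | all (fun p => logn p n == 0%N) s)
           a n * cos (2 * pi * phase N n t))%:E.
Proof.
elim: s t => [|p s IH] t sN //=.
have pN : p \in primes_upto N by apply: sN; rewrite inE eqxx.
have {}sN : {subset s <= primes_upto N} by move=> q qs; apply: sN; rewrite inE qs orbT.
transitivity (\int[@lebesgue_measure R]_(x in `[0%R, 1%R[%classic)
  (b + \sum_(n <- [seq n <- r | all (fun p => logn p n == 0%N) s])
     a n * cos (2 * pi * phase N n (fun k => if k == p then 0 else t k)
                + 2 * pi * ((logn p n)%:R * x)))%R%:E)%E.
  apply: eq_integral => x _; rewrite IH// big_filter.
  congr (_ + _)%:E; apply: eq_bigr => n _.
  by rewrite phase_update// mulrDr.
rewrite integral01_trig; congr (_ + _)%:E.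
rewrite big_filter_cond; apply: congr_big => // n; first by rewrite andbC.
by move=> /andP[_ /eqP np]; rewrite phase_update0.
Qed.

Lemma absF_ge_ReF N t : ReF N t <= absF N t.
Proof.
apply: le_trans (ler_norm _) _; rewrite -sqrtr_sqr ler_wsqrtr//.
by rewrite lerDl sqr_ge0.
Qed.

(** This makes the integral in [LqF] finite; at +oo, [fine] would return 0 and a lower bound on the
    integral would be lost. *)
Lemma absF_bounded N : exists M : R, forall t, absF N t <= M.
Proof.
pose S : R := \sum_(1 <= n < N.+1) (Num.sqrt n%:R)^-1.
have S0 : 0 <= S by apply: sumr_ge0 => n _; rewrite invr_ge0 sqrtr_ge0.
have bd (f : nat -> R) : (forall n, `|f n| <= 1) ->
    (\sum_(1 <= n < N.+1) f n / Num.sqrt n%:R) ^+ 2 <= S ^+ 2.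
  move=> f1; rewrite -[leLHS]real_normK ?num_real// lerXn2r ?nnegrE//.
  apply: le_trans (ler_norm_sum _ _ _) _; apply: ler_sum => n _.
  have i0 : 0 <= (Num.sqrt n%:R)^-1 :> R by rewrite invr_ge0 sqrtr_ge0.
  by rewrite normrM (ger0_norm i0) ler_piMl.
exists (Num.sqrt (S ^+ 2 + S ^+ 2)) => t; rewrite ler_wsqrtr//.
by apply: lerD; apply: bd => n; rewrite ?cos_max ?sin_max.
Qed.

(** Young's inequality for u and A^(q-1), with the conjugate exponents q and q/(q-1), gives the
    tangent line of u^q at A. *)
Lemma powR_tangent (q u A : R) : 1 < q -> 0 <= u -> 0 < A ->
  A `^ q - q * A `^ (q - 1) * A + q * A `^ (q - 1) * u <= u `^ q.
Proof.
move=> q1 u0 A0; have q0 : 0 < q by apply: lt_trans q1.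
have qB0 : 0 < q - 1 by rewrite subr_gt0.
have := @conjugate_powR R u (A `^ (q - 1)) q (q / (q - 1)) u0 (powR_ge0 _ _) q0.
rewrite divr_gt0// => /(_ isT).
rewrite -powRrM mulrCA divff ?gt_eqF// mulr1 invfM invrK.
have -> : q^-1 + q^-1 * (q - 1) = 1 by field; rewrite gt_eqF.
move=> /(_ erefl) h.
have {h} : q * (u * A `^ (q - 1)) <= u `^ q + (q - 1) * A `^ q.
  rewrite -(ler_pM2l q0) in h; apply: le_trans h _.
  by rewrite le_eqVlt; apply/orP; left; apply/eqP; field; rewrite gt_eqF.
have := mulr_powRB1 (ltW A0) q0.
have -> : q * A `^ (q - 1) * A = q * (A * A `^ (q - 1)) by ring.
by move=> ->; lra.
Qed.

Lemma cos_pi4_gt0 : 0 < cos (pi / 4 : R).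
Proof.
have p0 := pi_gt0 R; apply: cos_gt0_pihalf; apply/andP; split; lra.
Qed.

Lemma cos_pi4_le (x : R) : 0 <= x <= 8^-1 -> cos (pi / 4) <= cos (2 * pi * x).
Proof.
have p0 := pi_gt0 R; move=> /andP[x0 x1].
have h : 2 * pi * x <= pi / 4.
  have : 2 * pi * x <= 2 * pi * 8^-1 by rewrite ler_wpM2l// mulr_ge0// ltW.
  lra.
have h0 : 0 <= 2 * pi * x by rewrite !mulr_ge0// ltW.
rewrite leNgt ltr_cos ?in_itv/=; last 2 first.
- by apply/andP; split; lra.
- by rewrite h0/=; lra.
by rewrite -leNgt.
Qed.

(** The tangent is taken at a level A below the guaranteed mean, so the inner integral is at least
    A^q. The q-th root restores A, and the exponential is the q-th root of the lower bound for the
    measure of the box. *)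
Lemma LqF_lb N y (q A : R) : (2 <= N)%N -> (y <= N)%N -> 1 < q -> 0 < A ->
  A <= cos (pi / 4) * (smooth_count y N)%:R / Num.sqrt N%:R ->
  A * expR (- (7 * y.+1%:R * ln N%:R / q)) <= LqF N q.
Proof.
move=> N2 yN q1 A0 hA.
have q0 : 0 < q by apply: lt_trans q1.
have N0 : 0 < N%:R :> R by rewrite ltr0n ltnW.
have N1 : 1 <= N%:R :> R by rewrite ler1n ltnW.
(* primes_upto is increasing, so the large primes are integrated innermost. *)
pose s1 := [seq p <- iota 0 y.+1 | prime p].
pose s2 := [seq p <- iota y.+1 (N - y) | prime p].
have s12 : primes_upto N = s1 ++ s2.
  by rewrite /primes_upto -filter_cat -iotaD addSn subnKC.
(* A phase has at most N+1 summands, each with exponent at most N, so it is at most N (N+1) N^-7 <=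
   1/8, because 16 N^2 <= N^6. *)
pose delta : R := N%:R ^- 7.
have d0 : 0 < delta by rewrite invr_gt0 exprn_gt0.
have d1 : delta <= 1 by rewrite invf_le1 ?exprn_gt0// exprn_ege1.
pose f t := ((absF N t) `^ q)%:E.
pose G t := torus_int s2 f t.
have G0 t : (0 <= G t)%E.
  rewrite -[0%E](torus_int_cst R s2 0 t); apply: le_torus_int => u.
  by rewrite lee_fin powR_ge0.
pose K := q * A `^ (q - 1).
have K0 : 0 <= K by rewrite mulr_ge0 ?powR_ge0// ltW.
have GA t : (forall p, p \in s1 -> 0 <= t p <= delta) -> ((A `^ q)%:E <= G t)%E.
  move=> ht.
  (* The slope K is nonnegative, so |F_N| may be replaced by its real part in the tangent line; this
     gives a trigonometric polynomial to average. *)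
  pose a n := K / Num.sqrt n%:R; pose b := A `^ q - K * A.
  apply: le_trans (_ : (torus_int s2 (fun t =>
     (b + \sum_(n <- iota 1 N) a n * cos (2 * pi * phase N n t))%:E) t <= _)%E);
    last first.
    apply: le_torus_int => u; rewrite lee_fin.
    apply: le_trans (powR_tangent _ _ _ q1 (sqrtr_ge0 _) A0).
    rewrite lerD2l; apply: le_trans (ler_wpM2l K0 (absF_ge_ReF N u)).
    rewrite mulr_sumr /index_iota subSS subn0 le_eqVlt; apply/orP; left; apply/eqP.
    by apply: eq_bigr => n _; rewrite /a mulrAC mulrA.
  rewrite (torus_int_trig N); last by move=> p ps; rewrite s12 mem_cat ps orbT.
  rewrite lee_fin /b -addrA lerDl addrC subr_ge0.
  apply: le_trans (ler_wpM2l K0 hA) _.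
  rewrite /smooth_count -sum1_count natr_sum; set X := \sum_(_ <- _ | _) _.
  have -> : K * (cos (pi / 4) * X / Num.sqrt N%:R) =
    K * (cos (pi / 4) / Num.sqrt N%:R) * X by ring.
  rewrite mulr_sumr.
  rewrite big_seq_cond [leRHS]big_seq_cond.
  (* For n <= N, avoiding the primes in (y, N] is the same as being y-smooth. *)
  rewrite [leLHS](eq_bigl (fun n => (n \in iota 1 N) &&
     all (fun p => logn p n == 0%N) s2)); last first.
    move=> n; case: (boolP (n \in _)) => //=; rewrite mem_iota add1n ltnS => /andP[n0 nN].
    apply/allP/allP => [sm p|sm p].
      rewrite mem_filter mem_iota => /and3P[pp yp _].
      rewrite lognE pp n0/=; case: ifP => // pn.
      by have := sm p; rewrite mem_primes pp n0 pn leqNgt yp => /(_ isT).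
    rewrite mem_primes => /and3P[pp _ pn]; rewrite leqNgt; apply/negP => yp.
    have := sm p; rewrite mem_filter mem_iota pp yp addSn subnKC// ltnS.
    rewrite (leq_trans (dvdn_leq n0 pn))// => /(_ isT).
    by rewrite lognE pp n0 pn.
  apply: ler_sum => n /andP[]; rewrite mem_iota add1n ltnS => /andP[n0 nN] sn.
  have n0' : 0 < n%:R :> R by rewrite ltr0n.
  rewrite mulr1 /a.
  have -> : K / Num.sqrt n%:R * cos (2 * pi * phase N n t) =
     K * (cos (2 * pi * phase N n t) / Num.sqrt n%:R) by ring.
  apply: ler_wpM2l => //; apply: ler_pM.
  - exact: ltW cos_pi4_gt0.
  - by rewrite invr_ge0 sqrtr_ge0.
  - apply: cos_pi4_le.
    (* The angles at the large primes are not constrained by [ht], but their exponents in a smooth n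
       vanish. *)
    have tb p : p \in primes_upto N -> 0 <= (logn p n)%:R * t p <= N%:R * delta.
      rewrite s12 mem_cat => /orP[/ht/andP[t0 td]|ps].
        rewrite mulr_ge0//= ler_pM// ler_nat (leq_trans _ nN)//.
        by rewrite ltnW// ltn_logl.
      by rewrite (eqP (allP sn _ ps)) mul0r lexx mulr_ge0// ltW.
    apply/andP; split.
      by rewrite /phase big_seq sumr_ge0// => p /tb/andP[].
    apply: le_trans (_ : \sum_(p <- primes_upto N) N%:R * delta <= _).
      by rewrite /phase big_seq [leRHS]big_seq ler_sum// => p /tb/andP[].
    rewrite big_const_seq iter_addr_0 count_predT.
    apply: le_trans (_ : (N%:R * delta) * N.+1%:R <= _).
      rewrite -[leLHS]mulr_natr ler_wpM2l ?mulr_ge0 ?(ltW d0)// ler_nat.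
      by rewrite /primes_upto -{2}(size_iota 0 N.+1) size_filter count_size.
    rewrite /delta mulrAC ler_pdivrMr ?exprn_gt0// [leRHS]mulrC ler_pdivlMr//.
    rewrite -!natrM -natrX ler_nat.
    apply: (@leq_trans (N * (2 * N) * 8)).
      by rewrite leq_mul2r leq_mul2l mul2n -addnn -[N.+1]addn1 leq_add2l (ltnW N2) !orbT.
    apply: (@leq_trans (2 ^ 4 * N ^ 2)).
      by rewrite -mulnn; apply/eq_leq; ring.
    apply: (@leq_trans (N ^ 4 * N ^ 2)).
      by rewrite leq_mul2r leq_exp2r// N2 orbT.
    by rewrite -expnD leq_exp2l.
  - rewrite lef_pV2 ?posrE ?sqrtr_gt0//.
    by rewrite ler_wsqrtr// ler_nat.
have [M hM] := absF_bounded N.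
have lo : ((A `^ q * delta ^+ size s1)%:E <= torus_int (primes_upto N) f (fun=> 0%R))%E.
  rewrite s12 torus_int_cat; apply: torus_int_box => //.
  - exact: powR_ge0.
  - by rewrite d0.
have hi : (torus_int (primes_upto N) f (fun=> 0%R) <= (M `^ q)%:E)%E.
  rewrite -(torus_int_cst R (primes_upto N) (M `^ q) (fun=> 0)).
  apply: le_torus_int => t; rewrite lee_fin ge0_ler_powR ?nnegrE ?(ltW q0) ?sqrtr_ge0//.
  exact: le_trans (sqrtr_ge0 _) (hM t).
rewrite /LqF -/f.
apply: (@le_trans _ _ ((A `^ q * delta ^+ size s1) `^ q^-1)); last first.
  have p0 : 0 <= A `^ q * delta ^+ size s1 by rewrite mulr_ge0 ?powR_ge0// exprn_ge0// ltW.
  move: lo hi; case: (torus_int _ _ _) => [z| |]//=.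
  rewrite !lee_fin => lo _.
  by rewrite ge0_ler_powR ?nnegrE ?invr_ge0 ?(ltW q0)// (le_trans p0).
rewrite powRM ?powR_ge0 ?exprn_ge0 ?(ltW d0)//.
rewrite -powRrM divff ?gt_eqF// powRr1 ?(ltW A0)//.
rewrite ler_pM2l// /powR gt_eqF ?exprn_gt0// ler_expR.
rewrite lnXn// lnV ?posrE ?exprn_gt0// lnXn// mulNrn mulrN lerN2 mulrC.
rewrite ler_wpM2r ?invr_ge0 ?(ltW q0)//.
rewrite -mulrnA -[leLHS]mulr_natl ler_wpM2r ?ln_ge0// -natrM ler_nat.
by rewrite leq_mul2l /s1 -{2}(size_iota 0 y.+1) size_filter count_size.
Qed.

End LowerBound.

Theorem theorem4 (R : realType) (eps : R) (heps : 0 < eps) :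
  exists C : R, 0 < C /\
  exists N0 : nat, forall (N : nat) (q : R),
    (2 <= N)%N -> (N0 <= N)%N -> (N%:R `^ eps <= q) ->
    C * Num.sqrt (N%:R) <= LqF N q.
Proof.
pose a := eps / 12; have a0 : 0 < a by rewrite divr_gt0.
(* With a k >= 2, the bound w >= N^(a/2) gives w^k >= N. *)
pose k := (Num.truncn (2 / a)).+1.
have k2 : 2 / a <= k%:R by rewrite ltW// truncnS_gt.
have [c /andP[c0 c1] hc] := smooth_count_lb R k.
have k0 := cos_pi4_gt0 R.
(* For X = N^(eps/2), y+1 <= 2 X and ln N <= (2/eps) X, whence 7 (y+1) ln N <= (28/eps) N^eps. *)
exists (cos (pi / 4) * c * expR (- (28 / eps))); split.
  by rewrite !mulr_gt0// expR_gt0.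
(* N^a >= 2e yields w >= e, that is ln w >= 1; N^a >= 4 yields N^a / 2 >= N^(a/2). *)
pose L : R := 4 + 2 * expR 1.
have L4 : 4 <= L by rewrite /L lerDl mulr_ge0// expR_ge0.
have L0 : 0 < L by apply: lt_le_trans L4.
exists (Num.truncn (L `^ a^-1)).+1 => N q N2 NN0 hq.
have N0 : 0 < N%:R :> R by rewrite ltr0n ltnW.
have N1 : 1 <= N%:R :> R by rewrite ler1n ltnW.
have N1' : 1 < N%:R :> R by rewrite ltr1n.
have NL : L <= N%:R `^ a.
  have -> : L = (L `^ a^-1) `^ a.
    by rewrite -powRrM mulVf ?gt_eqF// powRr1// ltW.
  rewrite ge0_ler_powR ?nnegrE ?(ltW a0) ?powR_ge0// ?(ltW N0)//.
  apply: le_trans (_ : (Num.truncn (L `^ a^-1)).+1%:R <= _); last by rewrite ler_nat.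
  by rewrite ltW// truncnS_gt.
pose w := Num.truncn (N%:R `^ a).
have wle : w%:R <= N%:R `^ a by rewrite truncn_le// powR_ge0.
have wge : N%:R `^ a / 2 <= w%:R.
  have : N%:R `^ a < w%:R + 1 by rewrite natr1 truncnS_gt.
  lra.
have Lw : 1 <= ln (w%:R : R).
  have hw : expR 1 <= w%:R :> R.
    apply: le_trans wge; rewrite ler_pdivlMr//; apply: le_trans NL.
    by rewrite /L mulrC lerDr.
  have w0 := lt_le_trans (expR_gt0 1) hw.
  by rewrite -[leLHS](expRK 1) ler_ln ?posrE ?expR_gt0.
have w0 := ltnW (ln_ge1_nat_gt1 _ _ Lw).
have Nw : (N <= w ^ k)%N.
  rewrite -(ler_nat R) natrX.
  have h2 : N%:R `^ (a / 2) <= w%:R.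
    apply: le_trans wge.
    have E : N%:R `^ a = N%:R `^ (a / 2) * N%:R `^ (a / 2).
      by rewrite -powRD -?splitr// gt_eqF ?implybT.
    have : 2 <= N%:R `^ (a / 2).
      rewrite leNgt; apply/negP => h.
      have := ltr_pM (powR_ge0 _ _) (powR_ge0 _ _) h h.
      by rewrite -E; move: (le_trans L4 NL); lra.
    move=> h; rewrite E; have := ler_wpM2l (powR_ge0 N%:R (a / 2)) h; lra.
  apply: le_trans (lerXn2r k _ _ h2); rewrite ?nnegrE ?powR_ge0//.
  rewrite -powR_mulrn ?powR_ge0// -powRrM le1r_powR//.
  have := ler_wpM2l (ltW a0) k2; rewrite mulrCA divff ?gt_eqF//; lra.
have q1 : 1 < q.
  apply: lt_le_trans hq; have := @gt0_ltr_powR R eps heps 1 N%:R.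
  by rewrite !nnegrE powR1 => ->//; exact: ltW.
(* Capping at N meets the condition y <= N of [LqF_lb] and loses no smooth integer up to N. *)
pose y := minn (w ^ 6) N.
have yN : (y <= N)%N by rewrite geq_minr.
have ye : y%:R <= N%:R `^ (eps / 2).
  apply: le_trans (_ : (w ^ 6)%:R <= _); first by rewrite ler_nat geq_minl.
  have -> : eps / 2 = a * 6%:R by rewrite /a; field.
  by rewrite natrX powRrM powR_mulrn ?powR_ge0// lerXn2r ?nnegrE ?powR_ge0.
have sy : (smooth_count (w ^ 6) N <= smooth_count y N)%N.
  rewrite /smooth_count -!size_filter; apply: uniq_leq_size.
    by rewrite filter_uniq ?iota_uniq.
  move=> n; rewrite !mem_filter mem_iota add1n ltnS => /andP[/allP sn /andP[n0 nN]].
  rewrite n0 nN !andbT; apply/allP => p pn; rewrite leq_min sn//=.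
  by move: pn; rewrite mem_primes => /and3P[_ _ /dvdn_leq pn]; rewrite (leq_trans (pn _)).
apply: le_trans (LqF_lb R N y q (cos (pi / 4) * c * Num.sqrt N%:R) N2 yN q1 _ _).
- rewrite mulrAC ler_pM2l ?mulr_gt0 ?sqrtr_gt0// ler_expR lerN2.
  rewrite ler_pdivrMr; last by apply: lt_trans q1.
  apply: le_trans (ler_wpM2l _ hq); last by rewrite divr_ge0// ltW.
  have E : N%:R `^ eps = N%:R `^ (eps / 2) * N%:R `^ (eps / 2).
    by rewrite -powRD -?splitr// gt_eqF ?implybT.
  set X := N%:R `^ (eps / 2) in E ye *.
  have X0 : 0 < X by rewrite powR_gt0.
  have lnX : ln N%:R <= 2 / eps * X.
    have -> : ln N%:R = 2 / eps * (eps / 2 * ln N%:R) by field; rewrite gt_eqF.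
    rewrite ler_wpM2l ?divr_ge0 ?(ltW heps)// -ln_powR -/X.
    by rewrite ltW// ln_sublinear.
  have y1 : y.+1%:R <= 2 * X.
    have : 1 <= X by rewrite -(powRr0 N%:R) ler_powR// divr_ge0// ltW.
    rewrite -natr1; lra.
  have -> : 28 / eps * N%:R `^ eps = 7 * (2 * X) * (2 / eps * X).
    by rewrite E; ring.
  apply: ler_pM => //; rewrite ?mulr_ge0 ?ln_ge0// ler_wpM2l//.
- by rewrite !mulr_gt0// sqrtr_gt0.
- rewrite -!mulrA ler_pM2l// ler_pdivlMr ?sqrtr_gt0// -mulrA -expr2 sqr_sqrtr ?ler0n//.
  by apply: le_trans (hc _ _ Lw Nw) _; rewrite ler_nat.
Qed.
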